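(* Let $\Gamma$ be a primitive strongly regular graph with $v$ vertices, valency $k$, eigenvalues $k > e^+ > 0 > e^-$, where the multiplicity $m^-$ of $e^-$ satisfies $ve^- = m^-(e^- - k)$. If $\Gamma$ has $m^-+1$ Delsarte cocliques, then a symmetric $2$-$(\tilde v, \tilde k, c)$ design exists, where $\tilde v = \frac{(e^+)^2+ e^+e^-+e^+ - (e^-)^2}{(e^+)^2 + e^-}$, $\tilde k = \frac{(e^-+1)e^+}{(e^+)^2 + e^-}$ and $c = \frac{-(e^+)^2 + e^+}{(e^+)^2 + e^-}$, and $e^+ + 1$ divides $2c+4$.
   Context: A strongly regular graph has $v$ vertices, is $k$-regular, and the number of common neighbours of two distinct vertices depends only on whether they are adjacent; its adjacency matrix has eigenvalues $k \ge e^+ \ge 0 > e^-$, and $m^-$ is the multiplicity of $e^-$. Primitive means the graph and its complement are connected. A Delsarte coclique is a set of pairwise non-adjacent vertices of size $\frac{ve^-}{e^- - k}$. A symmetric $2$-$(\tilde v,\tilde k,c)$ design is a family of $\tilde k$-subsets (blocks) of a $\tilde v$-set such that every pair of distinct points lies in exactly $c$ blocks and any two distinct blocks meet in a constant number of points. *)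

(* Defs.v *)
From HB Require Import structures.
From mathcomp Require Import all_boot all_order all_algebra.
Set Implicit Arguments. Unset Strict Implicit. Unset Printing Implicit Defensive.
Import Order.TTheory GRing.Theory Num.Theory.
Local Open Scope ring_scope.

Definition srg (v : nat) (adj : rel 'I_v) (k lam mu : nat) : Prop :=
  [/\ symmetric adj, irreflexive adj,
      (forall x, #|[set y | adj x y]| = k),
      (forall x y, x != y -> adj x y ->
          #|[set z | adj x z && adj y z]| = lam) &
      (forall x y, x != y -> ~~ adj x y ->
          #|[set z | adj x z && adj y z]| = mu)].

Definition compl_rel (v : nat) (adj : rel 'I_v) : rel 'I_v :=
  fun x y => (x != y) && ~~ adj x y.

Definition primitive (v : nat) (adj : rel 'I_v) : Prop :=
  (forall x y, connect adj x y) /\ (forall x y, connect (compl_rel adj) x y).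

Definition adjmx (R : fieldType) (v : nat) (adj : rel 'I_v) : 'M[R]_v :=
  \matrix_(i, j) (adj i j)%:R.

Definition coclique (v : nat) (adj : rel 'I_v) (S : {set 'I_v}) : Prop :=
  forall x y, x \in S -> y \in S -> ~~ adj x y.

Definition delsarte_coclique (R : fieldType) (v : nat) (adj : rel 'I_v)
    (k : nat) (em : R) (S : {set 'I_v}) : Prop :=
  coclique adj S /\ (#|S|%:R : R) = v%:R * em / (em - k%:R).

Definition sym_design (vt kt c : nat) (B : {set {set 'I_vt}}) : Prop :=
  [/\ (forall b, b \in B -> #|b| = kt),
      (forall x y : 'I_vt, x != y ->
          #|[set b in B | (x \in b) && (y \in b)]| = c) &
      (exists l : nat, forall b1 b2, b1 \in B -> b2 \in B -> b1 != b2 ->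
          #|b1 :&: b2| = l)].
Arguments sym_design : clear implicits.

(* Main.v *)
(* Let E be the orthogonal projection onto the eigenspace of s = e^-.  It is a
   combination of A, I and J, so its trace gives m^-, and the hypothesis
   v s = m^- (s - k) then determines k, v and m = m^- from r = e^+ and s; in
   particular Delsarte cocliques have size m.  For such a coclique S the m
   projections of the unit vectors e_x, x in S, have an invertible Gram matrix
   of the form a I + b J, hence form a basis of the eigenspace, and inner
   products there can be computed from restrictions to S.  Applied to the
   vectors 1_T - (m/v) 1 of Delsarte cocliques T, which are in the eigenspace by
   the equality case of Hoffman's bound, this gives a quadratic equation for
   |T /\ S| with one root m, so |T /\ S| is constant for T <> S, and then also
   |T /\ T' /\ S| is constant.  Fixing S among the m + 1 cocliques, the traces on
   S of the m others are the blocks of a symmetric design.  Finally r is an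
   integer and c^2 k (1 + r) = r^2 (1 - r - r c) (1 - r - r c - c), which is
   2c + 4 modulo r + 1. *)

Require Import Defs.
From HB Require Import structures.
From mathcomp Require Import all_boot all_order all_algebra.
From mathcomp Require Import ring lra zify.
Set Implicit Arguments.
Unset Strict Implicit.
Unset Printing Implicit Defensive.

Import Order.TTheory GRing.Theory Num.Theory.
Local Open Scope ring_scope.

(** * Indicator sums, and general facts on matrices and integrality *)

Lemma sum_mem_mul (R : pzSemiRingType) (T : finType) (A B : {set T}) :
  \sum_x (x \in A)%:R * (x \in B)%:R = #|A :&: B|%:R :> R.
Proof.
rewrite -sum1_card natr_sum [RHS]big_mkcond /=; apply: eq_bigr => x _.
by rewrite inE -natrM mulnb; case: (_ && _).
Qed.

Lemma sum_mem (R : pzSemiRingType) (T : finType) (A : {set T}) :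
  \sum_x (x \in A)%:R = #|A|%:R :> R.
Proof.
rewrite -[in RHS](setIid A) -sum_mem_mul; apply: eq_bigr => x _.
by case: (x \in A); rewrite ?mulr1 ?mulr0.
Qed.

Lemma mul_const1 (R : pzRingType) (n : nat) :
  const_mx 1 *m (const_mx 1 : 'M[R]_n) = n%:R *: const_mx 1 :> 'M[R]_n.
Proof.
apply/matrixP=> i j; rewrite !mxE (eq_bigr (fun=> 1)); last first.
  by move=> h _; rewrite !mxE mulr1.
by rewrite sumr_const card_ord mulr1.
Qed.

(** In the rank factorisation [E = col_base E *m row_base E], idempotence forces the product in the
    other order to be the identity of size [\rank E]. *)
Lemma mxtrace_idem (F : fieldType) (n : nat) (E : 'M[F]_n) :
  E *m E = E -> \tr E = (\rank E)%:R.
Proof.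
move=> EE; rewrite -{1}(mulmx_base E) mxtrace_mulC.
suff -> : row_base E *m col_base E = 1%:M by rewrite mxtrace1.
apply: (row_full_inj (col_base_full E)); rewrite mulmx1.
apply: (row_free_inj (row_base_free E)).
by rewrite mulmxA mulmx_base -mulmxA mulmx_base.
Qed.

(* The incidence matrix [N] satisfies [N N^T = (l - c) I + c J], which is
   invertible; as [J] commutes with [N], also [N^T N = (l - c) I + c J]. *)
Lemma card_blocks_through_pair (n l c : nat) (f : 'I_n -> {set 'I_n}) :
    (c < l)%N -> (forall i, #|f i| = l) ->
    (forall i j, i != j -> #|f i :&: f j| = c) ->
  forall x y, x != y -> #|[set i | (x \in f i) && (y \in f i)]| = c.
Proof.
move=> lt_cl card_f card_fI x y neq_xy.
have n_gt0 : (0 < n)%N by apply: leq_trans (ltn_ord x).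
pose N : 'M[rat]_n := \matrix_(i, j) (j \in f i)%:R.
pose J : 'M[rat]_n := const_mx 1.
have JJ : J *m J = n%:R *: J by apply: mul_const1.
have JT : J^T = J by apply: trmx_const.
pose a : rat := l%:R - c%:R.
have a_gt0 : 0 < a by rewrite subr_gt0 ltr_nat.
have c_ge0 : (0 : rat) <= c%:R by rewrite ler0n.
have n_gt0R : (0 : rat) < n%:R by rewrite ltr0n.
have l_neq0 : (l%:R : rat) != 0 by rewrite pnatr_eq0 -lt0n; lia.
pose s : rat := a + c%:R * n%:R.
have s_gt0 : 0 < s by rewrite /s; nra.
have NNT : N *m N^T = a%:M + c%:R *: J.
  apply/matrixP=> i j; rewrite !mxE.
  rewrite (eq_bigr (fun h => (h \in f i)%:R * (h \in f j)%:R)); last first.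
    by move=> h _; rewrite !mxE.
  rewrite sum_mem_mul mulr1; case: eqVneq => [->|neq_ij].
    by rewrite setIid card_f mulr1n subrK.
  by rewrite card_fI // mulr0n add0r.
have NJ : N *m J = l%:R *: J.
  apply/matrixP=> i j; rewrite !mxE mulr1 -(card_f i) -sum_mem.
  by apply: eq_bigr => h _; rewrite !mxE mulr1.
have N_unit : N \in unitmx.
  (* This is the explicit inverse of [a I + c J]; [s] is its eigenvalue on constant vectors. *)
  suff : N *m (a^-1 *: (N^T *m (1%:M - (c%:R / s) *: J))) = 1%:M.
    by case/mulmx1_unit.
  rewrite -scalemxAr mulmxA NNT mulmxBr mulmx1 -scalemxAr mulmxDl.
  rewrite mul_scalar_mx -scalemxAl JJ; apply/matrixP=> i j; rewrite !mxE.
  have a_neq0 : a != 0 by rewrite gt_eqF.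
  have s_neq0 : s != 0 by rewrite gt_eqF.
  case: (i == j); rewrite ?mulr1n ?mulr0n; move: a_neq0 s_neq0;
    rewrite /s => ? ?; field; exact/andP.
have NTJ : l%:R *: (N^T *m J) = s *: J.
  apply: (can_inj (mulKmx N_unit)).
  rewrite -!scalemxAr mulmxA NNT NJ mulmxDl mul_scalar_mx -scalemxAl JJ.
  by rewrite !scalerA -scalerDl scalerA mulrC.
have JN : l%:R *: (J *m N) = s *: J.
  by move/(congr1 trmx): NTJ; rewrite !linearZ /= trmx_mul trmxK JT.
(* Computing [J N J] in two ways gives [s = l ^+ 2], which turns [JN] into [J N = l J]: the columns
   of [N] sum to [l] like its rows. *)
have sl2 : s = l%:R ^+ 2.
  have: l%:R *: (J *m N) *m J = s *: J *m J by rewrite JN.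
  rewrite -!scalemxAl -mulmxA NJ -scalemxAr JJ => /matrixP/(_ x y).
  by rewrite !mxE; nra.
have {}JN : J *m N = l%:R *: J.
  by apply: (can_inj (scalerK l_neq0)); rewrite JN sl2 scalerA expr2.
have NTN : N^T *m N = a%:M + c%:R *: J.
  apply: (can_inj (mulKmx N_unit)).
  rewrite mulmxA NNT mulmxDl mulmxDr -!scalemxAl -!scalemxAr JN NJ.
  by rewrite mul_scalar_mx mul_mx_scalar.
apply/eqP; rewrite -(eqr_nat rat) -sum_mem; apply/eqP.
move/matrixP/(_ x y): NTN; rewrite !mxE (negPf neq_xy) mulr0n add0r mulr1 => <-.
by apply: eq_bigr => i _; rewrite !mxE inE -natrM mulnb.
Qed.

(** The first equation makes [x] rational, and a rational root of a monic integer polynomial is an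
    integer: its reduced denominator divides the square of its numerator, to which it is coprime. *)
Lemma intr_root_monic (R : realFieldType) (x : R) (n N p q : int) :
    n != 0 -> n%:~R * x = N%:~R -> x ^+ 2 = p%:~R * x - q%:~R ->
  exists z : int, x = z%:~R.
Proof.
move=> n0 nx xx.
have n0R : (n%:~R : R) != 0 by rewrite intr_eq0.
have [y xy] : exists y : rat, x = ratr y.
  by exists (N%:~R / n%:~R); rewrite fmorph_div /= !ratr_int -nx mulrC mulKf.
have yy : y ^+ 2 = p%:~R * y - q%:~R.
  by apply: (fmorph_inj (@ratr R)); rewrite /=
    !(rmorphXn, rmorphB, rmorphM) /= !ratr_int -xy.
exists (numq y).
have d_dvd : (denq y %| numq y * numq y)%Z.
  apply/dvdzP; exists (p * numq y - q * denq y).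
  apply: (@intr_inj rat); rewrite !(rmorphM, rmorphB) /=.
  have d0 : ((denq y)%:~R : rat) != 0 by rewrite intr_eq0 denq_neq0.
  have Ey : y = (numq y)%:~R / (denq y)%:~R by rewrite divq_num_den.
  move: yy; rewrite {1 2}Ey => yy.
  have -> : ((numq y)%:~R * (numq y)%:~R : rat) =
     ((numq y)%:~R / (denq y)%:~R) ^+ 2 * (denq y)%:~R ^+ 2 by field.
  rewrite yy; field; exact d0.
have cop : coprimez (denq y) (numq y) by rewrite coprimez_sym; apply: coprime_num_den.
rewrite Gauss_dvdzr // in d_dvd.
have : (denq y %| 1)%Z by rewrite -(Gauss_dvdzr _ cop) mulr1.
rewrite dvdz1 => /eqP d1.
have {}d1 : denq y = 1 by rewrite -absz_denq d1.
by rewrite xy -[in LHS](divq_num_den y) d1 divr1 ratr_int.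
Qed.

Lemma mulmx_tr_eq0 (R : realDomainType) (n : nat) (w : 'rV[R]_n) :
  w *m w^T = 0 -> w = 0.
Proof.
move=> /matrixP/(_ 0 0); rewrite !mxE => sum0; apply/rowP=> i; rewrite mxE.
apply/eqP; rewrite -[_ == 0]orbb -mulf_eq0; apply/eqP.
have /psumr_eq0P H : \sum_j w 0 j * w 0 j = 0.
  by rewrite -[RHS]sum0; apply: eq_bigr => j _; rewrite mxE.
by apply: H => // j _; rewrite -expr2 sqr_ge0.
Qed.

Definition char_row (R : pzSemiRingType) (n : nat) (S : {set 'I_n}) : 'rV[R]_n :=
  \row_x (x \in S)%:R.

(** * The eigenspace of the negative eigenvalue *)

Section SrgMatrix.

Variables (R : realFieldType) (v : nat) (A : 'M[R]_v) (k r s : R).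
Variable m : nat.

Let J : 'M[R]_v := const_mx 1.
(** In a strongly regular graph the product of the two other eigenvalues is [mu - k], so this [mu]
    counts the common neighbours of non-adjacent vertices. [t] is the density of a set of size
    [m]. *)
Let mu : R := k + r * s.
Let kappa : R := (k - r) / v%:R.
Let t : R := m%:R / v%:R.
Let chi (S : {set 'I_v}) : 'rV[R]_v := char_row R S.

Hypothesis v_gt0 : (0 < v)%N.
Hypothesis trA : A^T = A.
Hypothesis mxtraceA : \tr A = 0.
Hypothesis AJ : A *m J = k *: J.
Hypothesis AA : A *m A = (r + s) *: A - (r * s)%:M + mu *: J.
Hypothesis rk : r < k.
Hypothesis r_gt0 : 0 < r.
Hypothesis s_lt0 : s < 0.
Hypothesis rank_s : \rank (eigenspace A s) = m.
Hypothesis vs_eq : v%:R * s = m%:R * (s - k).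

Let vR_gt0 : (0 : R) < v%:R. Proof. by rewrite ltr0n. Qed.
Let v_neq0 : (v%:R : R) != 0. Proof. by rewrite gt_eqF. Qed.
Let sr_neq0 : s - r != 0.
Proof. by rewrite subr_eq0 lt_eqF // (lt_trans s_lt0 r_gt0). Qed.

Lemma const1A : J *m A = k *: J.
Proof.
by move/(congr1 trmx): AJ; rewrite linearZ /= trmx_mul trA trmx_const.
Qed.

Lemma srg_muE : (k - r) * (k - s) = mu * v%:R.
Proof.
have: A *m A *m J = k ^+ 2 *: J.
  by rewrite -mulmxA AJ -scalemxAr AJ scalerA.
rewrite AA mulmxDl mulmxBl -!scalemxAl AJ mul_scalar_mx mul_const1.
move=> /matrixP/(_ (Ordinal v_gt0) (Ordinal v_gt0)); rewrite !mxE !mulr1.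
by nra.
Qed.

Lemma eigen_mul_const1 (n : nat) (W : 'M[R]_(n, v)) :
  W *m A = s *: W -> W *m J = 0.
Proof.
move=> WA; have: W *m A *m J = k *: (W *m J) by rewrite -mulmxA AJ scalemxAr.
rewrite WA -scalemxAl => /eqP; rewrite -subr_eq0 -scalerBl scaler_eq0.
by case/orP=> [|/eqP //];
  rewrite lt_eqF // subr_lt0 (lt_trans s_lt0) // (lt_trans r_gt0).
Qed.

(** [A - r] kills the eigenspace of [r] and acts as [s - r] on that of [s]; subtracting [kappa J]
    also kills the constants, where [A - r] acts as [k - r]. *)
Definition eigenproj : 'M[R]_v := (s - r)^-1 *: (A - r%:M - kappa *: J).

Local Notation E := eigenproj.

Lemma eigenproj_mul (n : nat) (W : 'M[R]_(n, v)) : W *m A = s *: W -> W *m E = W.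
Proof.
move=> WA; rewrite -scalemxAr !mulmxBr WA mul_mx_scalar -scalemxAr.
rewrite (eigen_mul_const1 WA) scaler0 subr0 -scalerBl scalerA mulVf //.
exact: scale1r.
Qed.

Lemma eigenprojA : E *m A = s *: E.
Proof.
rewrite -scalemxAl !mulmxBl mul_scalar_mx -scalemxAl const1A AA.
rewrite [in RHS]/eigenproj [in RHS]scalerA (mulrC s) -[in RHS]scalerA; congr (_ *: _).
have kE : kappa * (k - s) = mu.
  by rewrite /kappa mulrAC srg_muE mulfK.
apply/matrixP=> i j; rewrite !mxE -kE.
by case: (i == j); rewrite ?mulr1n ?mulr0n; ring.
Qed.

Lemma eigenproj_idem : E *m E = E.
Proof. exact: eigenproj_mul eigenprojA. Qed.

Lemma tr_eigenproj : E^T = E.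
Proof.
by apply/matrixP=> i j; rewrite !mxE -{1}trA mxE eq_sym.
Qed.

Lemma rank_eigenproj : \rank E = m.
Proof.
rewrite -rank_s; apply/eqP; rewrite eqn_leq; apply/andP; split.
  by apply/mxrankS/eigenspaceP/eigenprojA.
apply: mxrankS; rewrite -(eigenproj_mul (eigenspaceP (submx_refl _))).
exact: submxMl.
Qed.

(** The trace of the idempotent [E] is its rank [m], and [A] has trace zero. *)
Lemma multiplicityE : m%:R * (r - s) = r * v%:R + k - r.
Proof.
have /esym := mxtrace_idem eigenproj_idem.
rewrite rank_eigenproj mxtraceZ !raddfB /= mxtraceA mxtrace_scalar mxtraceZ.
have -> : \tr J = v%:R.
  rewrite /mxtrace (eq_bigr (fun=> 1)); last by move=> i _; rewrite mxE.
  by rewrite sumr_const card_ord.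
rewrite -mulr_natr /kappa divfK // => ->; field; exact: sr_neq0.
Qed.

(** Eliminating [m] between [vs_eq] and the trace identity produces [(k - r) * (k - s)], which is
    [mu * v]; then [v] cancels throughout. *)
Lemma valencyE : k * (1 + r) = s * (s - r).
Proof.
have := multiplicityE; have := srg_muE; rewrite /mu => H1 H2.
apply: (mulfI v_neq0).
have : v%:R * s * (r - s) = (s - k) * (m%:R * (r - s)) by rewrite vs_eq; ring.
rewrite H2; nra.
Qed.

Lemma eigen_muE : mu * (1 + r) = s * (s + r ^+ 2).
Proof. by rewrite /mu mulrDl valencyE; ring. Qed.

(** [srg_muE] shows [mu > 0], and [s < 0], so the other factor in [eigen_muE] is negative. It is the
    denominator of all three design parameters. *)
Lemma eigen_lt : s + r ^+ 2 < 0.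
Proof.
have mu_gt0 : 0 < mu.
  rewrite -(pmulr_lgt0 _ vR_gt0) -srg_muE mulr_gt0 // subr_gt0 //.
  exact: lt_trans (lt_trans s_lt0 r_gt0) rk.
have : 0 < mu * (1 + r) by rewrite mulr_gt0 // ltr_wpDr // ltW.
by rewrite eigen_muE nmulr_rgt0.
Qed.

(** * Delsarte cocliques as vectors of the eigenspace, and their Gram matrix *)

Lemma mul_char_tr (S T : {set 'I_v}) : chi S *m (chi T)^T = #|S :&: T|%:R%:M.
Proof.
apply/matrixP=> i j; rewrite !mxE !ord1 mulr1n -sum_mem_mul.
by apply: eq_bigr => x _; rewrite !mxE.
Qed.

(** By [vs_eq] the Delsarte size [v s / (s - k)] equals [m], so these are the Delsarte cocliques,
    read off the matrix. *)
Definition msized_coclique (T : {set 'I_v}) : Prop :=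
  #|T| = m /\ forall x y, x \in T -> y \in T -> A x y = 0.

Definition centred (T : {set 'I_v}) : 'rV[R]_v := chi T - t *: chi setT.

Let JE : J = (chi setT)^T *m chi setT.
Proof. by apply/matrixP=> i j; rewrite !mxE big_ord1 !mxE !inE mulr1. Qed.

Let card_setT : #|[set: 'I_v]| = v. Proof. by rewrite cardsT card_ord. Qed.

Let chiT_A : chi setT *m A = k *: chi setT.
Proof.
apply/rowP=> j; move/matrixP/(_ (Ordinal v_gt0) j): const1A; rewrite !mxE inE => <-.
by apply: eq_bigr => i _; rewrite !mxE inE.
Qed.

Let A_chiT : A *m (chi setT)^T = k *: (chi setT)^T.
Proof. by move/(congr1 trmx): chiT_A; rewrite trmx_mul linearZ /= trA. Qed.

Let t_v : t * v%:R = m%:R. Proof. by rewrite /t divfK. Qed.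

Let tr_centred (T : {set 'I_v}) :
  (centred T)^T = (chi T)^T - t *: (chi setT)^T.
Proof. by apply/matrixP=> i j; rewrite !mxE. Qed.

Lemma centred_mul_tr (T T' : {set 'I_v}) : #|T| = m -> #|T'| = m ->
  centred T *m (centred T')^T = (#|T :&: T'|%:R - t * m%:R)%:M.
Proof.
move=> cT cT'; rewrite tr_centred /centred mulmxBl !mulmxBr.
rewrite -!scalemxAl -!scalemxAr !mul_char_tr setTI !setIT card_setT cT cT'.
apply/matrixP=> i j; rewrite !ord1 !mxE !mulr1n t_v; ring.
Qed.

Lemma centred_const1 (T : {set 'I_v}) : #|T| = m -> centred T *m J = 0.
Proof.
move=> cT; rewrite JE mulmxA /centred mulmxBl -!scalemxAl !mul_char_tr.
by rewrite setTI setIT card_setT cT scale_scalar_mx t_v subrr mul0mx.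
Qed.

(* Equality case of Hoffman's bound: [w := u A - s u] satisfies
   [w w^T = (r - s) w u^T], and [w u^T = 0] is the numerical hypothesis. *)
Lemma centred_eigen (T : {set 'I_v}) :
  msized_coclique T -> centred T *m A = s *: centred T.
Proof.
move=> [cT T0]; set u := centred T.
have uJ : u *m J = 0 by apply: centred_const1.
have aAa : chi T *m A *m (chi T)^T = 0.
  apply/matrixP=> i j; rewrite !mxE big1 // => y _; rewrite !mxE.
  case Ty: (y \in T); last by rewrite mulr0.
  rewrite mulr1 big1 // => x _; rewrite mxE.
  by case Tx: (x \in T); rewrite ?mul0r // T0 // mulr0.
have uAu : u *m A *m u^T = (s * (m%:R - t * m%:R))%:M.
  rewrite /u tr_centred /centred !mulmxBl -!scalemxAl chiT_A.
  rewrite !mulmxBr -!scalemxAr -!scalemxAl aAa -!mulmxA A_chiT -!scalemxAr.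
  rewrite !mul_char_tr setTI !setIT card_setT cT.
  have sm : s * m%:R = t * (m%:R * (s - k)) by rewrite -vs_eq -t_v; ring.
  have ttvk : t * t * v%:R * k = t * m%:R * k by rewrite -t_v; ring.
  by apply/matrixP=> i j; rewrite !ord1 !mxE !mulr1n; lra.
have uu : u *m u^T = (m%:R - t * m%:R)%:M by rewrite centred_mul_tr // setIid cT.
set w := u *m A - s *: u.
(* [(A - s)(A - r)] equals [mu J], which [u] annihilates. *)
have wA : w *m A = r *: w.
  rewrite /w mulmxBl -mulmxA AA mulmxDr mulmxBr -!scalemxAr -scalemxAl uJ scaler0.
  rewrite mul_mx_scalar; apply/rowP=> i; rewrite !mxE; ring.
have wu : w *m u^T = 0.
  rewrite /w mulmxBl -scalemxAl uAu uu.
  apply/matrixP=> i j; rewrite !ord1 !mxE !mulr1n; ring.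
apply/eqP; rewrite -subr_eq0; apply/eqP/mulmx_tr_eq0; rewrite -/w.
have -> : w^T = A *m u^T - s *: u^T.
  by rewrite -{1}trA -trmx_mul; apply/matrixP=> i j; rewrite !mxE.
rewrite mulmxBr -scalemxAr mulmxA wA.
by rewrite -scalemxAl wu !scaler0 subrr.
Qed.

Lemma centred_eigenproj (T : {set 'I_v}) :
  msized_coclique T -> centred T *m E = centred T.
Proof. by move=> ?; apply/eigenproj_mul/centred_eigen. Qed.

(** On a coclique the entries of [E] are [gram_off], plus [gram_diag] on the diagonal. [gram_corr]
    is the coefficient in the inverse [gram_diag^-1 (I - gram_corr J)] of this matrix of size
    [m]. *)
Definition gram_diag : R := r / (r - s).
Definition gram_off : R := (k - r) / (v%:R * (r - s)).
Definition gram_corr : R := gram_off / (gram_diag + gram_off * m%:R).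

Let rs_gt0 : 0 < r - s. Proof. by rewrite subr_gt0 (lt_trans s_lt0 r_gt0). Qed.
Lemma gram_diag_gt0 : 0 < gram_diag. Proof. exact: divr_gt0. Qed.
Lemma gram_off_gt0 : 0 < gram_off.
Proof. by apply: divr_gt0; [rewrite subr_gt0 | apply: mulr_gt0]. Qed.

(* The projections of the unit vectors of [S] span the eigenspace, since
   their Gram matrix, [gram_diag I + gram_off J], is invertible and [#|S|] is
   its dimension.  So the inner product of two vectors of the eigenspace is
   read off their restrictions to [S]. *)
Lemma eigen_mul_tr (S : {set 'I_v}) (w w' : 'rV[R]_v) :
    msized_coclique S -> w *m E = w -> w' *m E = w' ->
  w *m w'^T = gram_diag^-1 *: (w *m diag_mx (chi S) *m w'^T -
     gram_corr *: ((w *m (chi S)^T) *m (chi S *m w'^T))).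
Proof.
move=> [cS S0] wE w'E.
set D := diag_mx (chi S); set JS := (chi S)^T *m chi S.
have DD : D *m D = D.
  rewrite mulmx_diag; congr diag_mx; apply/rowP=> i; rewrite !mxE.
  by case: (i \in S); rewrite ?mulr1 ?mulr0.
have chiD : chi S *m D = chi S.
  rewrite mul_mx_diag; apply/rowP=> i; rewrite !mxE.
  by case: (i \in S); rewrite ?mulr1 ?mulr0.
have DT : D^T = D by rewrite tr_diag_mx.
have Dchi : D *m (chi S)^T = (chi S)^T by rewrite -{1}DT -trmx_mul chiD.
have DJ : D *m JS = JS by rewrite mulmxA Dchi.
have JD : JS *m D = JS by rewrite -mulmxA chiD.
have JJ : JS *m JS = m%:R *: JS.
  rewrite mulmxA -(mulmxA _ (chi S)) mul_char_tr setIid cS.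
  by rewrite mul_mx_scalar -scalemxAl.
have DED : D *m E *m D = gram_diag *: D + gram_off *: JS.
  rewrite mul_diag_mx mul_mx_diag; apply/matrixP=> i j; rewrite !mxE big_ord1 !mxE.
  have rs0 : r - s != 0 by rewrite gt_eqF.
  rewrite /gram_diag /gram_off /kappa.
  case Si: (i \in S); case Sj: (j \in S);
    rewrite ?mul0r ?mulr0 ?mul0rn ?mulr0 ?addr0 //.
    rewrite (S0 _ _ Si Sj) mulr1 mul1r; case: (i == j); rewrite ?mulr1n ?mulr0n.
      by field; rewrite v_neq0 rs0 sr_neq0.
    by field; rewrite v_neq0 rs0 sr_neq0.
  by case: eqP Si Sj => [->|_]; [move=> -> | rewrite mulr0n mulr0].
(* [H] is the inverse of the Gram matrix on [S], padded with zeros outside [S]. *)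
set H := gram_diag^-1 *: (D - gram_corr *: JS).
have a_neq0 : gram_diag != 0 by rewrite gt_eqF // gram_diag_gt0.
have ab_neq0 : gram_diag + gram_off * m%:R != 0.
  by rewrite gt_eqF // ltr_pwDl ?gram_diag_gt0 // mulr_ge0 // ltW // gram_off_gt0.
have DEDH : D *m E *m D *m H = D.
  rewrite DED mulmxDl -!scalemxAl -!scalemxAr !mulmxBr -!scalemxAr DD DJ JD JJ.
  apply/matrixP=> i j; rewrite !mxE big_ord1 !mxE /gram_corr.
  by field; rewrite a_neq0 ab_neq0.
have DH : D *m H = H by rewrite -scalemxAr mulmxBr -scalemxAr DD DJ.
have rankD : \rank D = m.
  apply/eqP; rewrite -(eqr_nat R) -(mxtrace_idem DD) mxtrace_diag -cS -sum_mem.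
  by apply/eqP/eq_bigr=> i _; rewrite mxE.
(* [D = D E D H] has rank [m], so [D E] has rank at least [m], the rank of [E]. *)
have E_sub : (E <= D *m E)%MS.
  rewrite -(geq_leqif (mxrank_leqif_sup (submxMl D E))) rank_eigenproj.
  by rewrite -{1}rankD -{1}DEDH -[_ *m D *m H]mulmxA mxrankM_maxl.
have /submxP[c wc] : (w <= D *m E)%MS.
  by apply: submx_trans E_sub; rewrite -wE submxMl.
have Ew' : E *m w'^T = w'^T by rewrite -[in LHS]tr_eigenproj -trmx_mul w'E.
transitivity (w *m H *m w'^T).
  rewrite -DH [in RHS]wc !mulmxA.
  rewrite -(mulmxA _ E D) -(mulmxA c) -(mulmxA c) (mulmxA D) DEDH.
  by rewrite {1}wc -!mulmxA Ew'.
by rewrite -scalemxAr -scalemxAl mulmxBr -scalemxAr mulmxBl -scalemxAl !mulmxA.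
Qed.

(** * Intersection numbers of Delsarte cocliques *)

Lemma intersection_formula (S T T' : {set 'I_v}) :
    msized_coclique S -> msized_coclique T -> msized_coclique T' ->
  gram_diag * (#|T :&: T'|%:R - t * m%:R) =
  #|T :&: T' :&: S|%:R - t * (#|T :&: S|%:R + #|T' :&: S|%:R) + t ^+ 2 * m%:R
  - gram_corr * ((#|T :&: S|%:R - t * m%:R) * (#|T' :&: S|%:R - t * m%:R)).
Proof.
move=> dS dT dT'; have [cS _] := dS; have [cT _] := dT; have [cT' _] := dT'.
have := eigen_mul_tr dS (centred_eigenproj dT) (centred_eigenproj dT').
have -> : centred T *m diag_mx (chi S) = chi (T :&: S) - t *: chi S.
  rewrite mul_mx_diag; apply/rowP=> x; rewrite !mxE !inE.
  by case: (x \in T); case: (x \in S) => /=; ring.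
have -> : chi S *m (centred T')^T = (#|T' :&: S|%:R - t * m%:R)%:M.
  rewrite tr_centred mulmxBr -scalemxAr !mul_char_tr setIT cS setIC.
  by rewrite scale_scalar_mx -raddfB.
have -> : centred T *m (chi S)^T = (#|T :&: S|%:R - t * m%:R)%:M.
  rewrite /centred mulmxBl -scalemxAl !mul_char_tr setTI cS.
  by rewrite scale_scalar_mx -raddfB.
rewrite centred_mul_tr // tr_centred mulmxBl !mulmxBr -!scalemxAl -!scalemxAr.
rewrite !mul_char_tr !setIT cS (setIC S T') -scalar_mxM setIAC.
move=> /matrixP/(_ 0 0); rewrite !mxE !mulr1n => ->.
by rewrite mulVKf ?gt_eqF ?gram_diag_gt0 //; ring.
Qed.

(** Multiplying [multiplicityE] by [s] lets [vs_eq] remove [v]; multiplying by [1 + r] then lets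
    [valencyE] remove [k]. *)
Lemma multiplicity_closed : m%:R * (r ^+ 2 + s) = r ^+ 2 + r * s + r - s ^+ 2.
Proof.
have s_neq0 : s != 0 by rewrite lt_eqF.
have mr := multiplicityE; have kr := valencyE.
apply: (mulfI s_neq0).
have H : m%:R * (r * k - s ^+ 2) = (k - r) * s.
  have : r * (v%:R * s) = s * (m%:R * (r - s)) - (k - r) * s by rewrite mr; ring.
  by rewrite vs_eq => H; lra.
have : (1 + r) * (m%:R * (r * k - s ^+ 2)) = (1 + r) * ((k - r) * s) by rewrite H.
have -> : (1 + r) * (m%:R * (r * k - s ^+ 2)) =
  m%:R * (r * (k * (1 + r)) - s ^+ 2 * (1 + r)) by ring.
have -> : (1 + r) * ((k - r) * s) = (k * (1 + r) - r * (1 + r)) * s by ring.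
by rewrite kr => {}H; lra.
Qed.

Lemma card_coclique_neq (S T : {set 'I_v}) :
  #|S| = m -> #|T| = m -> T != S -> (#|T :&: S| < m)%N.
Proof.
move=> cS cT neqTS; rewrite ltn_neqAle -{2}cS subset_leq_card ?subsetIr // andbT.
apply: contraNneq neqTS => cI; have /eqP TI : T :&: S == T.
  by rewrite eqEcard subsetIl cI cT leqnn.
have /eqP SI : T :&: S == S by rewrite eqEcard subsetIr cI cS leqnn.
by rewrite -[T]TI SI.
Qed.

(* [x = #|T :&: S|] satisfies a quadratic equation of which [x = m], i.e. the
   case [T = S], is one root. *)
Lemma card_coclique2 (S T : {set 'I_v}) :
    msized_coclique S -> msized_coclique T -> T != S ->
  #|T :&: S|%:R * (r ^+ 2 + s) = (s + 1) * r.
Proof.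
move=> dS dT neqTS; have [cS _] := dS; have [cT _] := dT.
have := intersection_formula dS dT dT; have := intersection_formula dS dS dS.
rewrite !setIid cS cT; set x : R := #|_ :&: _|%:R => fS fT.
have xm : x - m%:R != 0.
  by rewrite subr_eq0 eqr_nat neq_ltn card_coclique_neq.
have {fS fT} lin : 1 - 2 * t = gram_corr * (x + m%:R - 2 * t * m%:R).
  apply: (mulfI xm); move: fT; rewrite fS => fT.
  lra.
have corrE : gram_corr * (r * v%:R + (k - r) * m%:R) = k - r.
  rewrite /gram_corr /gram_diag /gram_off.
  have rs0 : r - s != 0 by rewrite gt_eqF.
  have den0 : r * v%:R + (k - r) * m%:R != 0.
    by rewrite gt_eqF // ltr_pwDl ?mulr_gt0 // mulr_ge0 // subr_ge0 ltW.
  by field; rewrite v_neq0 rs0.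
have key : r * (v%:R - 2 * m%:R) = (k - r) * x.
  have : (1 - 2 * t) * (r * v%:R + (k - r) * m%:R) =
    gram_corr * (r * v%:R + (k - r) * m%:R) * (x + m%:R - 2 * t * m%:R).
    by rewrite lin; ring.
  rewrite corrE => H; rewrite -[in m%:R]t_v; move: H; rewrite -t_v => H.
  lra.
(* Multiplying [key] by [k - s] turns [(k - r) * (k - s)] into [mu * v] and [m * (k - s)] into
   [- v * s], so [v] cancels. *)
have xmu : mu * x = r * (k + s).
  apply: (mulfI v_neq0).
  have -> : v%:R * (mu * x) = (k - s) * ((k - r) * x).
    by rewrite [RHS]mulrA (mulrC (k - s)) srg_muE; ring.
  rewrite -key; have : r * (v%:R * s) = r * (m%:R * (s - k)) by rewrite vs_eq.
  by move=> H; lra.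
have s_neq0 : s != 0 by rewrite lt_eqF.
apply: (mulfI s_neq0).
have -> : s * (x * (r ^+ 2 + s)) = mu * (1 + r) * x by rewrite eigen_muE; ring.
have -> : mu * (1 + r) * x = mu * x * (1 + r) by ring.
rewrite xmu; have -> : r * (k + s) * (1 + r) = r * (k * (1 + r) + s * (1 + r)) by ring.
by rewrite valencyE; ring.
Qed.

(** By [card_coclique2] the three pairwise intersections have equal size, so subtracting
    [intersection_formula] for [T, T'] from the one for [T, T] leaves only the triple intersection
    unknown. *)
Lemma card_coclique3 (S T T' : {set 'I_v}) :
    msized_coclique S -> msized_coclique T -> msized_coclique T' ->
    T != S -> T' != S -> T' != T ->
  (r - s) * (#|T :&: S|%:R - #|T :&: T' :&: S|%:R) = r * (m%:R - #|T :&: S|%:R).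
Proof.
move=> dS dT dT' TS T'S T'T; have [cT _] := dT.
have rs0 : r ^+ 2 + s != 0 by rewrite addrC lt_eqF // eigen_lt.
have eq1 : #|T' :&: S|%:R = #|T :&: S|%:R :> R.
  by apply: (mulIf rs0); rewrite !card_coclique2.
have eq2 : #|T :&: T'|%:R = #|T :&: S|%:R :> R.
  by apply: (mulIf rs0); rewrite setIC !card_coclique2.
have := intersection_formula dS dT dT; have := intersection_formula dS dT dT'.
rewrite eq1 eq2 setIid cT => f1 f2.
have : gram_diag * (m%:R - #|T :&: S|%:R) = #|T :&: S|%:R - #|T :&: T' :&: S|%:R.
  have -> : gram_diag * (m%:R - #|T :&: S|%:R) =
    gram_diag * (m%:R - t * m%:R) - gram_diag * (#|T :&: S|%:R - t * m%:R) by ring.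
  by rewrite f1 f2; ring.
move=> <-; rewrite mulrA /gram_diag [_ * (r / _)]mulrC divfK //.
by rewrite gt_eqF.
Qed.

End SrgMatrix.

(** * Adjacency matrices *)

Section SrgGraph.

Variables (R : realFieldType) (v : nat) (adj : rel 'I_v) (k lam mu : nat).
Hypothesis adj_srg : srg adj k lam mu.

Local Notation A := (adjmx R adj).
Local Notation J := (const_mx 1 : 'M[R]_v).

Lemma tr_adjmx : A^T = A.
Proof.
by case: adj_srg => adjC _ _ _ _; apply/matrixP=> i j; rewrite !mxE adjC.
Qed.

Lemma mxtrace_adjmx : \tr A = 0.
Proof.
case: adj_srg => _ adjN _ _ _; apply: big1 => i _.
by rewrite mxE adjN.
Qed.

Lemma adjmx_const1 : A *m J = k%:R *: J.
Proof.
case: adj_srg => _ _ deg _ _; apply/matrixP=> i j; rewrite !mxE mulr1.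
rewrite -(deg i) -sum_mem; apply: eq_bigr => x _.
by rewrite !mxE mulr1 inE.
Qed.

Lemma adjmx_sqr :
  A *m A = (lam%:R - mu%:R) *: A - (mu%:R - k%:R)%:M + mu%:R *: J.
Proof.
case: adj_srg => adjC adjN deg hlam hmu; apply/matrixP=> i j; rewrite !mxE.
have -> : \sum_h A i h * A h j = #|[set z | adj i z && adj j z]|%:R.
  rewrite -sum_mem; apply: eq_bigr => x _.
  by rewrite !mxE inE (adjC x) -natrM mulnb.
case: eqVneq => [<-|neq_ij].
  rewrite adjN mulr0 mulr1n mulr1.
  have -> : [set z | adj i z && adj i z] = [set z | adj i z].
    by apply/setP=> z; rewrite !inE andbb.
  by rewrite deg; ring.
case Aij: (adj i j); first by rewrite hlam // mulr0n mulr1n; ring.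
by rewrite hmu ?Aij // !mulr0n; ring.
Qed.

(** An eigenvector for [a != k] is orthogonal to the constants, so the [J] term of [adjmx_sqr]
    vanishes on it. *)
Lemma srg_eigenvalue (a : R) : eigenvalue A a -> a != k%:R ->
  a ^+ 2 = (lam%:R - mu%:R) * a + (k%:R - mu%:R).
Proof.
case/eigenvalueP=> w wA w0 ak.
have wJ : w *m J = 0.
  have: w *m A *m J = k%:R *: (w *m J) by rewrite -mulmxA adjmx_const1 scalemxAr.
  rewrite wA -scalemxAl => /eqP; rewrite -subr_eq0 -scalerBl scaler_eq0.
  by rewrite subr_eq0 (negPf ak) => /eqP.
have : w *m A *m A = w *m (A *m A) by rewrite mulmxA.
rewrite adjmx_sqr wA -scalemxAl wA mulmxDr mulmxBr -!scalemxAr wA wJ mul_mx_scalar.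
rewrite scaler0 addr0 !scalerA -scalerBl => /eqP.
rewrite -subr_eq0 -scalerBl scaler_eq0 (negPf w0) orbF subr_eq0 => /eqP aa.
by rewrite expr2 aa; ring.
Qed.

End SrgGraph.

(** * Integrality, and the design *)

Lemma vieta2 (F : fieldType) (x y b c : F) : x != y ->
  x ^+ 2 = b * x + c -> y ^+ 2 = b * y + c -> x + y = b /\ x * y = - c.
Proof.
move=> neq_xy xx yy; have sum_xy : x + y = b.
  apply: (mulfI (x := x - y)); first by rewrite subr_eq0.
  have -> : (x - y) * (x + y) = x ^+ 2 - y ^+ 2 by ring.
  by rewrite xx yy; ring.
split=> //; rewrite -sum_xy in xx.
have -> : c = x ^+ 2 - (x + y) * x by rewrite [in RHS]xx; ring.
ring.
Qed.

(* [k (1 + r) = s (s - r)] is linear in [r] over the integers once [s] and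
   [s ^+ 2] are eliminated. *)
Lemma positive_eigenvalue_int (R : realFieldType) (r s : R) (k lam mu : nat) :
    0 < r -> s < 0 -> k%:R * (1 + r) = s * (s - r) ->
    r + s = lam%:R - mu%:R -> r * s = mu%:R - k%:R ->
  exists z : int, r = z%:~R.
Proof.
move=> r_gt0 s_lt0 kE sum_rs prod_rs.
have [p pE] : exists p : int, p%:~R = r + s.
  by exists (lam%:Z - mu%:Z); rewrite rmorphB.
have [q qE] : exists q : int, q%:~R = r * s.
  by exists (mu%:Z - k%:Z); rewrite rmorphB.
have rs_lt0 : r * s < 0 by rewrite pmulr_rlt0.
(* [k + r + s = lam - r * s], which is positive. *)
have kp_neq0 : k%:R + (r + s) != 0.
  apply/eqP=> kp0.
  have lam_ge0 : (0 : R) <= lam%:R by rewrite ler0n.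
  by lra.
apply: (@intr_root_monic R r (k%:Z + p) (p ^+ 2 - q - q - k%:Z) p q).
- apply: contraNneq kp_neq0 => kp0.
  by rewrite -pE -[k%:R]/(k%:Z%:~R) -rmorphD /= kp0.
- rewrite !(rmorphD, rmorphB, rmorphXn, rmorphN) /= pE qE -[k%:Z%:~R]/(k%:R).
  by lra.
- by rewrite pE qE; ring.
Qed.

Lemma dvd_2c4 (k c zr : int) :
    c ^+ 2 * (k * (1 + zr)) =
      zr ^+ 2 * ((1 - zr - zr * c) * (1 - zr - zr * c - c)) ->
  exists z : int, 2 * c + 4 = z * (zr + 1).
Proof.
move=> H; pose X := zr + 1; pose d := 1 + c.
(* With [zr = X - 1], the two linear factors multiply to [2 * c + 4 + X * W], and
   [zr ^+ 2 = 1 + X * (X - 2)]; the witness collects the multiples of [X]. *)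
pose W := X * d ^+ 2 - d * (4 + c).
exists (c ^+ 2 * k - (W + (X - 2) * (4 + 2 * c) + X * (X - 2) * W)).
rewrite mulrBl -[_ * k * _]mulrA [zr + 1]addrC H /W /X /d; ring.
Qed.

Lemma card_preim_inj (aT rT : finType) (g : aT -> rT) (X S : {set rT}) :
  injective g -> g @: [set: aT] = S -> #|[set p | g p \in X]| = #|X :&: S|.
Proof.
move=> g_inj gS; rewrite -(card_imset _ g_inj) -gS.
congr #|pred_of_set _|; apply/setP=> x; apply/imsetP/setIP.
  by case=> p; rewrite inE => Xp ->; split=> //; apply: imset_f.
by case=> Xx /imsetP[p _ xE]; exists p => //; rewrite inE -xE.
Qed.

Lemma enum_set (T : finType) (m : nat) (X : {set T}) : #|X| = m ->
  exists g : 'I_m -> T, injective g /\ g @: [set: 'I_m] = X.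
Proof.
move=> <-; exists enum_val; split; first exact: enum_val_inj.
apply/setP=> x; apply/imsetP/idP => [[i _ ->]|Xx]; first exact: enum_valP.
by exists (enum_rank_in Xx x); rewrite ?enum_rankK_in.
Qed.

(** [c < l] makes [f] injective, so counting blocks amounts to counting indices, and
    [card_blocks_through_pair] applies. *)
Lemma sym_design_of_intersections (n l c : nat) (f : 'I_n -> {set 'I_n}) :
    (c < l)%N -> (forall i, #|f i| = l) ->
    (forall i j, i != j -> #|f i :&: f j| = c) ->
  sym_design n l c (f @: [set: 'I_n]).
Proof.
move=> lt_cl card_f card_fI.
have f_inj : injective f.
  move=> i j fij; apply: contraTeq lt_cl => /card_fI.
  by rewrite fij setIid card_f => ->; rewrite ltnn.
split.
- by move=> _ /imsetP[i _ ->].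
- move=> x y neq_xy; rewrite -(card_blocks_through_pair lt_cl card_f card_fI neq_xy).
  rewrite -(card_imset _ f_inj); congr #|pred_of_set _|; apply/setP=> b.
  rewrite inE; apply/andP/imsetP.
    by case=> /imsetP[i _ ->] xy; exists i; rewrite ?inE.
  by case=> i; rewrite inE => xy ->; split=> //; apply: imset_f.
exists c => _ _ /imsetP[i _ ->] /imsetP[j _ ->] neq_f.
by apply: card_fI; apply: contraNneq neq_f => ->.
Qed.

Theorem theorem7p4 (R : rcfType) (v : nat) (adj : rel 'I_v)
    (k lam mu : nat) (ep em : R) :
  srg adj k lam mu ->
  primitive adj ->
  (* the eigenvalues of the adjacency matrix are k > e^+ > 0 > e^- *)
  eigenvalue (adjmx R adj) ep ->
  eigenvalue (adjmx R adj) em ->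
  (forall a : R, eigenvalue (adjmx R adj) a -> [\/ a = k%:R, a = ep | a = em]) ->
  k%:R > ep -> ep > 0 -> 0 > em ->
  (* m^- = multiplicity of e^-, and v e^- = m^- (e^- - k) *)
  v%:R * em = (\rank (eigenspace (adjmx R adj) em))%:R * (em - k%:R) ->
  (* Gamma has m^- + 1 (distinct) Delsarte cocliques *)
  (exists C : {set {set 'I_v}},
      #|C| = (\rank (eigenspace (adjmx R adj) em)).+1 /\
      forall S, S \in C -> delsarte_coclique adj k em S) ->
  exists vt kt c : nat,
    [/\ (vt%:R : R) = (ep ^+ 2 + ep * em + ep - em ^+ 2) / (ep ^+ 2 + em),
        (kt%:R : R) = ((em + 1) * ep) / (ep ^+ 2 + em),
        (c%:R : R) = (- ep ^+ 2 + ep) / (ep ^+ 2 + em),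
        (exists B : {set {set 'I_vt}}, sym_design vt kt c B) &
        (* e^+ + 1 divides 2c + 4 *)
        (exists z : int, ((2 * c + 4)%N%:R : R) = z%:~R * (ep + 1))].
Proof.
move=> adj_srg _ eig_r eig_s _ r_lt_k r_gt0 s_lt0 vs_eq [C [card_C delC]].
set r := ep in eig_r r_lt_k r_gt0 *; set s := em in eig_s s_lt0 vs_eq delC card_C *.
set A := adjmx R adj in eig_r eig_s vs_eq card_C.
move Em: (\rank (eigenspace A s)) => m in vs_eq card_C.
have v_gt0 : (0 < v)%N.
  case/eigenvalueP: eig_s => w _ w0; rewrite lt0n; apply: contraNneq w0 => v0.
  by apply/eqP/rowP=> -[i lti]; exfalso; rewrite v0 in lti.
have vR_gt0 : (0 : R) < v%:R by rewrite ltr0n.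
have r_neq_k : r != k%:R by rewrite lt_eqF.
have s_neq_k : s != k%:R by rewrite lt_eqF //; lra.
have r_neq_s : r != s by rewrite gt_eqF //; lra.
have [sum_rs prod_rs] : r + s = lam%:R - mu%:R /\ r * s = mu%:R - k%:R.
  rewrite -[mu%:R - k%:R]opprB; apply: (vieta2 r_neq_s).
    exact: (srg_eigenvalue (R := R) adj_srg eig_r r_neq_k).
  exact: (srg_eigenvalue (R := R) adj_srg eig_s s_neq_k).
have AJ := adjmx_const1 R adj_srg; rewrite -/A in AJ.
have AA : A *m A = (r + s) *: A - (r * s)%:M + (k%:R + r * s) *: const_mx 1.
  by rewrite sum_rs prod_rs (addrC k%:R) subrK; apply: adjmx_sqr.
have trA : A^T = A by apply: tr_adjmx adj_srg.
have mxtrA : \tr A = 0 by apply: mxtrace_adjmx adj_srg.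
have kE := valencyE v_gt0 trA mxtrA AJ AA r_lt_k r_gt0 s_lt0 Em vs_eq.
have mE := multiplicity_closed v_gt0 trA mxtrA AJ AA r_lt_k r_gt0 s_lt0 Em vs_eq.
have rs_lt0 : r ^+ 2 + s < 0.
  by rewrite addrC; apply: (eigen_lt v_gt0 trA mxtrA AJ AA r_lt_k r_gt0 s_lt0 Em vs_eq).
have rs_neq0 : r ^+ 2 + s != 0 by rewrite lt_eqF.
have [zr zrE] := positive_eigenvalue_int r_gt0 s_lt0 kE sum_rs prod_rs.
(* Two cocliques other than [S] are needed to define [c]. If [m = 1] then [s = -1] and [k = 1],
   leaving no integer [r] with [0 < r < k]. *)
have m_gt1 : (1 < m)%N.
  case: m mE vs_eq {Em card_C} => [|[|//]] mE vs_eq.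
    by move: vs_eq; rewrite mul0r => /eqP;
      rewrite mulf_eq0 (gt_eqF vR_gt0) (lt_eqF s_lt0).
  have s1 : s = -1.
    apply/eqP; rewrite -subr_eq0 opprK; apply/eqP.
    apply: (mulfI (x := r - s)); first by rewrite subr_eq0.
    by move: mE; rewrite mul1r mulr0 => mE; lra.
  have k1 : k%:R = 1 :> R.
    apply: (mulIf (x := 1 + r)); first by rewrite gt_eqF //; lra.
    by rewrite kE s1; ring.
  have zr_gt0 : 0 < zr by rewrite -(ltr0z R) -zrE.
  have zr_lt1 : zr < 1 by rewrite -(ltrz1 R) -zrE -k1.
  by lia.
have delm S : S \in C -> msized_coclique A m S.
  move=> /delC[coS cardS]; split.
    apply/eqP; rewrite -(eqr_nat R) cardS vs_eq mulfK // subr_eq0 //.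
  by move=> x y Sx Sy; rewrite mxE (negPf (coS x y Sx Sy)).
have [S SC] : exists S, S \in C by apply/card_gt0P; rewrite card_C.
have dS := delm S SC; have [cardS _] := dS.
have cardC' : #|C :\ S| = m.
  by move: card_C; rewrite (cardsD1 S) SC => -[].
(* The points are the vertices of [S] and the blocks come from the other cocliques; there are [m] of
   each, so ['I_m] indexes both. *)
have [g [g_inj gS]] := enum_set cardS.
have [T [T_inj TC]] := enum_set cardC'.
have TP i : T i \in C :\ S by rewrite -TC imset_f.
have dT i : msized_coclique A m (T i) by apply: delm; move: (TP i) => /setD1P[].
have TS i : T i != S by move: (TP i) => /setD1P[].
pose i0 := Ordinal (ltnW m_gt1); pose i1 := Ordinal m_gt1.
pose l := #|T i0 :&: S|; pose c := #|T i0 :&: T i1 :&: S|.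
have lE : l%:R * (r ^+ 2 + s) = (s + 1) * r.
  exact: (card_coclique2 v_gt0 trA mxtrA AJ AA r_lt_k r_gt0 s_lt0 Em vs_eq
    dS (dT i0) (TS i0)).
have card_TS i : #|T i :&: S| = l.
  apply/eqP; rewrite -(eqr_nat R); apply/eqP/(mulIf rs_neq0); rewrite lE.
  exact: (card_coclique2 v_gt0 trA mxtrA AJ AA r_lt_k r_gt0 s_lt0 Em vs_eq
    dS (dT i) (TS i)).
have rs_neq0' : r - s != 0 by rewrite subr_eq0.
have cE i j : i != j -> (r - s) * (l%:R - #|T i :&: T j :&: S|%:R) = r * (m%:R - l%:R).
  move=> neq_ij; rewrite -(card_TS i).
  apply: (card_coclique3 v_gt0 trA mxtrA AJ AA r_lt_k r_gt0 s_lt0 Em vs_eq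
    dS (dT i) (dT j) (TS i) (TS j)).
  by rewrite (inj_eq T_inj) eq_sym.
have card_TTS i j : i != j -> #|T i :&: T j :&: S| = c.
  move=> neq_ij; apply/eqP; rewrite -(eqr_nat R).
  rewrite -(inj_eq (@oppr_inj R)) -(inj_eq (addrI l%:R)) -(inj_eq (mulfI rs_neq0')).
  by rewrite !cE.
have lm : (l < m)%N by apply: card_coclique_neq cardS (proj1 (dT i0)) (TS i0).
have cl : (c < l)%N.
  rewrite -(ltr_nat R) -subr_gt0.
  have rs_gt0 : 0 < r - s by lra.
  by rewrite -(pmulr_rgt0 _ rs_gt0) cE // mulr_gt0 // subr_gt0 ltr_nat.
have c_eq : c%:R * (r ^+ 2 + s) = - r ^+ 2 + r.
  apply: (mulfI rs_neq0').
  have -> : (r - s) * (c%:R * (r ^+ 2 + s)) =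
    (r - s) * (l%:R * (r ^+ 2 + s)) - (r - s) * (l%:R - c%:R) * (r ^+ 2 + s) by ring.
  rewrite cE //.
  have -> : r * (m%:R - l%:R) * (r ^+ 2 + s) =
    r * (m%:R * (r ^+ 2 + s) - l%:R * (r ^+ 2 + s)) by ring.
  by rewrite lE mE; ring.
exists m, l, c; split.
- by rewrite -mE mulfK.
- by rewrite -lE mulfK.
- by rewrite -c_eq mulfK.
- exists ((fun i => [set p | g p \in T i]) @: [set: 'I_m]).
  apply: sym_design_of_intersections => //.
    by move=> i; rewrite (card_preim_inj _ g_inj gS).
  move=> i j neq_ij; rewrite -(card_TTS i j neq_ij) -(card_preim_inj _ g_inj gS).
  by congr #|pred_of_set _|; apply/setP=> p; rewrite !inE.
have [z zE] : exists z : int, 2 * c%:Z + 4 = z * (zr + 1).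
  apply: (@dvd_2c4 k%:Z); apply: (@intr_inj R).
  rewrite !(rmorphM, rmorphD, rmorphN, rmorphXn, rmorph1) /= -zrE.
  rewrite -[k%:Z%:~R]/(k%:R) -[c%:Z%:~R]/(c%:R) kE.
  (* This is [c_eq] solved for [c * s]. The left side of the divisibility identity is
     [c ^+ 2 * s * (s - r)] by [kE], so [s] can be eliminated through [c * s]. *)
  have cs : c%:R * s = r * (1 - r - r * c%:R) by lra.
  have -> : c%:R ^+ 2 * (s * (s - r)) = c%:R * s * (c%:R * s - c%:R * r) by ring.
  by rewrite cs; ring.
exists z; rewrite zrE -[1]/(1%:~R) -rmorphD -rmorphM /= -zE.
by rewrite natrD natrM rmorphD rmorphM.
Qed.
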